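(* Let $M$ be a matroid that is nearly finitary and nearly cofinitary. Then $\big((M^{\mathrm{fin}})^*\vee M\big)^*$ is a matroid.
   Context: Matroids (possibly infinite) satisfy: $\emptyset$ independent; subsets of independent sets are independent; if $B$ is maximal independent and $A$ is non-maximal independent, then $A\cup\{b\}$ is independent for some $b\in B\setminus A$; for independent $A\subseteq X\subseteq E$ there is a maximal independent set $S$ with $A\subseteq S\subseteq X$. Bases are maximal independent sets. The dual $M^*$ has as independent sets the subsets of complements of bases of $M$. The finitarization $M^{\mathrm{fin}}$ has as independent sets those sets all of whose finite subsets are independent in $M$ (it is a matroid). $M$ is nearly finitary if $F\setminus B$ is finite whenever a base $F$ of $M^{\mathrm{fin}}$ contains a base $B$ of $M$; $M$ is nearly cofinitary if $M^*$ is nearly finitary. The union $A\vee B$ has ground set $E(A)\cup E(B)$ and independent sets $\{S\cup T: S$ independent in $A$, $T$ independent in $B\}$. *)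

(* Defs.v *)
From Stdlib Require Import List.

Definition tset (T : Type) := T -> Prop.
Definition tsubset {T} (A B : tset T) : Prop := forall x, A x -> B x.
Definition tempty {T} : tset T := fun _ => False.
Definition tfinite {T} (A : tset T) : Prop := exists l : list T, forall x, A x -> In x l.

Record setsys (T : Type) := SetSys {
  ground : tset T;
  indep : tset T -> Prop }.
Arguments ground {T} _ _.
Arguments indep {T} _ _.

Definition base {T} (M : setsys T) (B : tset T) : Prop :=
  indep M B /\ forall B', indep M B' -> tsubset B B' -> tsubset B' B.

Definition maxindep_in {T} (M : setsys T) (X S : tset T) : Prop :=
  indep M S /\ tsubset S X /\
  forall S', indep M S' -> tsubset S S' -> tsubset S' X -> tsubset S' S.

Definition is_matroid {T} (M : setsys T) : Prop :=
  (forall I, indep M I -> tsubset I (ground M)) /\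
  indep M tempty /\
  (forall A B, indep M B -> tsubset A B -> indep M A) /\
  (forall A B, base M B -> indep M A -> ~ base M A ->
     exists b, B b /\ ~ A b /\ indep M (fun x => A x \/ x = b)) /\
  (forall A X, indep M A -> tsubset A X -> tsubset X (ground M) ->
     exists S, maxindep_in M X S /\ tsubset A S).

Definition dual {T} (M : setsys T) : setsys T :=
  @SetSys T (ground M)
    (fun I => tsubset I (ground M) /\
              exists B, base M B /\ forall x, I x -> ~ B x).

Definition finitarization {T} (M : setsys T) : setsys T :=
  @SetSys T (ground M)
    (fun I => tsubset I (ground M) /\
              forall F, tfinite F -> tsubset F I -> indep M F).

Definition munion {T} (A B : setsys T) : setsys T :=
  @SetSys T (fun x => ground A x \/ ground B x)
    (fun I => exists S U, indep A S /\ indep B U /\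
                          forall x, I x <-> (S x \/ U x)).

Definition nearly_finitary {T} (M : setsys T) : Prop :=
  forall F B, base (finitarization M) F -> base M B -> tsubset B F ->
    tfinite (fun x => F x /\ ~ B x).

Definition nearly_cofinitary {T} (M : setsys T) : Prop :=
  nearly_finitary (dual M).

(* Main.v *)
(* Write P = (M^fin)^*.  The sets D whose complement is covered by a P-independent
   and an M-independent set satisfy an exchange property: if W + d is such a set,
   W is not, and D is another one, then W + z is such a set for some z in D.
   Indeed, let R be the set of elements that can become the uncovered one by single
   exchanges; the traces on R of the two independent sets span R in P and in M, so
   if R avoided D, then the traces on R of the pair belonging to D could replace
   them, and W would be such a set too.

   A base B of M extends to a base F of M^fin, and (E - F) together with B misses
   only F - B, which is finite.  So there are finite sets D of least size, and by the
   exchange property every D contains one of them.  Hence the dual of the union is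
   the system of subsets of the least D, a matroid of finite rank. *)
From Stdlib Require Import List Permutation Classical Lia.
From Stdlib Require Import FunctionalExtensionality PropExtensionality.
From mathcomp Require classical_sets.
Require Import Defs.

(** * Exchange, circuits and spanning in possibly infinite matroids *)

Definition add {T} (A : tset T) (x : T) : tset T := fun z => A z \/ z = x.

Definition swap {T} (A : tset T) (y x : T) : tset T :=
  fun z => (A z /\ z <> y) \/ z = x.

Lemma tset_ext {T} (A B : tset T) : (forall x, A x <-> B x) -> A = B.
Proof.
  intro H; apply functional_extensionality; intro x.
  apply propositional_extensionality; apply H.
Qed.

Section Matroid.
Context {T : Type} {M : setsys T} (HM : is_matroid M).

Lemma indep_ground I : indep M I -> tsubset I (ground M).
Proof. apply HM. Qed.

Lemma indep_sub A B : indep M B -> tsubset A B -> indep M A.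
Proof. apply HM. Qed.

Lemma base_exchange A B : base M B -> indep M A -> ~ base M A ->
  exists b, B b /\ ~ A b /\ indep M (add A b).
Proof. apply HM. Qed.

Lemma maxindep_extend A X : indep M A -> tsubset A X -> tsubset X (ground M) ->
  exists S, maxindep_in M X S /\ tsubset A S.
Proof. apply HM. Qed.

Lemma base_extend A : indep M A -> exists B, base M B /\ tsubset A B.
Proof.
  intro HA.
  destruct (maxindep_extend A (ground M)) as (B & (HB & _ & Hmax) & HAB);
    auto using indep_ground; [now intros x|].
  exists B; split; [split|]; auto using indep_ground.
Qed.

Lemma maxindep_intro X S : indep M S -> tsubset S X ->
  (forall x, X x -> ~ S x -> ~ indep M (add S x)) -> maxindep_in M X S.
Proof.
  intros HS HSX H; split; [|split]; auto.
  intros S' HS' HSS' HS'X x Hx; apply NNPP; intro Hn.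
  apply (H x); auto.
  apply (indep_sub _ S'); auto.
  intros z [Hz | ->]; auto.
Qed.

Lemma maxindep_dep X S x : maxindep_in M X S -> X x -> ~ S x ->
  ~ indep M (add S x).
Proof.
  intros (HS & HSX & Hmax) Hx Hn Hi; apply Hn.
  apply (Hmax (add S x)); auto.
  - intros z Hz; now left.
  - intros z [Hz | ->]; auto.
  - now right.
Qed.

Lemma not_maxindep X A : indep M A -> tsubset A X -> ~ maxindep_in M X A ->
  exists x, X x /\ ~ A x /\ indep M (add A x).
Proof.
  intros HA HAX Hn; apply NNPP; intro H; apply Hn, maxindep_intro; auto.
  intros x Hx Hnx Hi; apply H; eauto.
Qed.

(** If [S] were not a base, it could be enlarged by an element of [B], hence inside [X]. *)
Lemma maxindep_base X B S : base M B -> tsubset B X -> maxindep_in M X S ->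
  base M S.
Proof.
  intros HB HBX HS; apply NNPP; intro Hn.
  destruct (base_exchange S B) as (b & Hb & Hnb & Hi); auto; [apply HS|].
  now apply (maxindep_dep X S b) in Hi; auto.
Qed.

(** The exchange axiom for the restriction to [X]. Complete [S] to a base [B] and enlarge [A] by
    elements of [B] outside [X]; exchanges in the whole matroid are then forced back into [X]. *)
Lemma exchange_in X S A : tsubset X (ground M) -> maxindep_in M X S ->
  indep M A -> tsubset A X -> ~ maxindep_in M X A ->
  exists s, S s /\ ~ A s /\ indep M (add A s).
Proof.
  intros HXE HS HA HAX Hn.
  destruct (not_maxindep X A) as (x & HXx & HAx & HAxi); auto.
  destruct (base_extend S) as (B & HB & HSB); [apply HS|].
  assert (HBX : forall b, B b -> X b -> S b).
  { intros b Hb HXb; apply NNPP; intro Hnb.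
    apply (maxindep_dep X S b); auto.
    apply (indep_sub _ B); [apply HB|]. intros z [Hz | ->]; auto. }
  destruct (maxindep_extend A (fun z => A z \/ (B z /\ ~ X z)))
    as (A1 & HA1 & HAA1); auto.
  { now intros z Hz; left. }
  { intros z [Hz | [Hz _]]; auto. now apply (indep_ground B); [apply HB|]. }
  (* If [A1] is a base, adding [x] to [A] forces out some [z] of [B] outside [X]. Then [H] below is
     a proper subset of [B], and enlarging it from the base [A2] enlarges [S] inside [X], which is
     impossible. *)
  destruct (classic (base M A1)) as [HbA1 | HbA1].
  - destruct (maxindep_extend (add A x) (add A1 x)) as (A2 & HA2 & HAA2); auto.
    { intros z [Hz | Hz]; [left | right]; auto. }
    { intros z [Hz | ->]; auto. now apply (indep_ground A1); [apply HA1|]. }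
    assert (HbA2 : base M A2).
    { apply (maxindep_base (add A1 x) A1); auto. now intros z Hz; left. }
    destruct (classic (tsubset A1 A2)) as [Hs | Hs].
    { exfalso. destruct HbA1 as [_ Hm1].
      specialize (Hm1 A2 (proj1 HA2) Hs x (HAA2 x (or_intror eq_refl))).
      destruct HA1 as (_ & HA1 & _). destruct (HA1 x Hm1) as [? | [_ ?]]; auto. }
    apply not_all_ex_not in Hs; destruct Hs as [z Hz].
    apply imply_to_and in Hz; destruct Hz as [Hz1 Hz2].
    assert (HzB : B z /\ ~ X z).
    { destruct (proj1 (proj2 HA1) z Hz1) as [Hz | Hz]; auto.
      exfalso; apply Hz2, HAA2; now left. }
    set (H := fun w => S w \/ (A2 w /\ B w /\ ~ X w)).
    assert (HH : indep M H).
    { apply (indep_sub _ B); [apply HB|]. intros w [Hw | (_ & Hw & _)]; auto. }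
    destruct (base_exchange H A2) as (b & Hb & Hnb & Hi); auto.
    { intros [_ Hm]. destruct (Hm B (proj1 HB)) with z as [Hz | [Hz _]];
        try tauto.
      - intros w [Hw | (_ & Hw & _)]; auto.
      - apply HzB. now apply (proj1 (proj2 HS)). }
    assert (HXb : X b).
    { destruct (proj1 (proj2 HA2) b Hb) as [Hb' | ->]; auto.
      destruct (proj1 (proj2 HA1) b Hb') as [Hb'' | Hb'']; auto.
      exfalso; apply Hnb; right; tauto. }
    exfalso. apply (maxindep_dep X S b); auto.
    + intro; apply Hnb; now left.
    + apply (indep_sub _ (add H b)); auto.
      intros w [Hw | Hw]; [left; left | right]; auto.
  - destruct (base_exchange A1 B) as (b & Hb & Hnb & Hi); auto; [apply HA1|].
    destruct (classic (X b)) as [HXb | HXb].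
    + exists b; split; [|split]; auto.
      apply (indep_sub _ (add A1 b)); auto.
      intros w [Hw | Hw]; [left | right]; auto.
    + exfalso. now apply (maxindep_dep _ A1 b HA1) in Hi; auto.
Qed.

(* The [y] with [swap I y x] independent are those of the fundamental circuit of [x]. *)
Lemma fundamental_circuit I Q x : indep M I -> ground M x ->
  ~ indep M (add I x) -> tsubset Q I ->
  (forall y, I y -> indep M (swap I y x) -> Q y) -> ~ indep M (add Q x).
Proof.
  intros HI Hx HIx HQI HQ HQx.
  assert (HIE : tsubset (add I x) (ground M)).
  { intros z [Hz | ->]; auto. now apply (indep_ground I). }
  destruct (maxindep_extend (add Q x) (add I x)) as (S & HS & HQS); auto.
  { intros z [Hz | Hz]; [left | right]; auto. }
  assert (HSx : S x) by (apply HQS; now right).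
  assert (Hy : ~ tsubset I S).
  { intro H; apply HIx, (indep_sub _ S); [apply HS|]. intros z [Hz | ->]; auto. }
  apply not_all_ex_not in Hy; destruct Hy as [y Hy].
  apply imply_to_and in Hy; destruct Hy as [HIy HSy].
  (* The element gained from [S] can only be [x], since [y] is not in [S]. So [swap I y x] is
     independent, which puts [y] into [Q] and hence into [S]. *)
  destruct (exchange_in (add I x) S (fun z => I z /\ z <> y))
    as (s & Hs & Hns & Hi); auto.
  - apply (indep_sub _ I); auto. now intros z [Hz _].
  - intros z [Hz _]; now left.
  - intro Hmax. apply (maxindep_dep _ _ y Hmax); [now left | tauto |].
    apply (indep_sub _ I); auto. intros z [[Hz _] | ->]; auto.
  - destruct (proj1 (proj2 HS) s Hs) as [HsI | ->].
    + apply Hns; split; congruence.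
    + apply HSy, HQS; left; auto.
Qed.

Definition spans (Q : tset T) (z : T) : Prop := Q z \/ ~ indep M (add Q z).

(** Exchanging [y] for an element [x] spanned by [Q] does not enlarge the span. Otherwise the
    swapped set is maximal in [Q] with [x] and [z] while [Q] is not, and exchange could only add [x]
    to [Q]. *)
Lemma spans_swap Q x y z : indep M (swap Q y x) -> Q y -> indep M Q ->
  ground M z -> ~ Q x -> ~ indep M (add Q x) ->
  spans (swap Q y x) z -> spans Q z.
Proof.
  intros HQ' Hy HQ Hz Hnx Hx Hsp; apply NNPP; intro Hn.
  apply not_or_and in Hn; destruct Hn as [HQz HQzi]; apply NNPP in HQzi.
  assert (Hz' : ~ swap Q y x z).
  { intros [[H _] | ->]; auto. }
  destruct Hsp as [H | Hsp]; [auto|].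
  set (X := fun w => Q w \/ w = x \/ w = z).
  destruct (exchange_in X (swap Q y x) Q) as (s & Hs & Hns & Hi); auto.
  - intros w [Hw | [-> | ->]]; auto.
    + now apply (indep_ground Q).
    + apply (indep_ground (swap Q y x)); auto. now right.
  - apply maxindep_intro; auto.
    + intros w [[Hw _] | ->]; [left | right; left]; auto.
    + intros w Hw Hnw Hi.
      destruct Hw as [Hw | [-> | ->]]; auto.
      * apply Hx, (indep_sub _ (add (swap Q y x) w)); auto.
        assert (w = y) by (apply NNPP; intro; apply Hnw; left; auto).
        subst w. intros v [Hv | ->]; [|left; now right].
        destruct (classic (v = y)); [now right | left; left; auto].
      * apply Hnw; now right.
  - intros w Hw; now left.
  - intro Hmax. apply (maxindep_dep _ _ z Hmax); auto. now right; right.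
  - destruct Hs as [[Hs _] | ->]; auto.
Qed.

(** Independence in the contraction of [R] does not depend on the maximal independent subset of [R]
    used: [P] outside [R] stays independent over any independent [J] inside [R]. *)
Lemma indep_replace R P J : tsubset R (ground M) -> indep M P ->
  maxindep_in M R (fun z => P z /\ R z) -> indep M J -> tsubset J R ->
  indep M (fun z => (P z /\ ~ R z) \/ J z).
Proof.
  intros HRE HP HPR HJ HJR.
  destruct (maxindep_extend J R) as (J' & HJ' & HJJ'); auto.
  set (Y := fun z => (P z /\ ~ R z) \/ J' z).
  assert (HPE := indep_ground P HP).
  destruct (maxindep_extend J' Y) as (S & HS & HJS).
  { apply HJ'. }
  { now intros z Hz; right. }
  { intros z [[Hz _] | Hz]; auto. apply HRE, HJ'; auto. }
  set (X := fun z => P z \/ R z).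
  assert (HXE : tsubset X (ground M)) by (intros z [Hz | Hz]; auto).
  assert (HSX : tsubset S X).
  { intros z Hz. destruct (proj1 (proj2 HS) z Hz) as [[H _] | H]; [now left|].
    right; now apply HJ'. }
  assert (HPX : forall r, R r -> ~ P r -> ~ indep M (add P r)).
  { intros r Hr Hn Hi. apply (maxindep_dep _ _ r HPR); auto; [tauto|].
    apply (indep_sub _ (add P r)); auto.
    intros w [[Hw _] | Hw]; [left | right]; auto. }
  (* Both [P] and [S] are maximal in [X]. If [S] missed some [p] of [P] outside [R], exchanging [p]
     out of [P] would bring in an element of [R], against the maximality of the trace of [P] on
     [R]. *)
  assert (HSmax : maxindep_in M X S).
  { apply NNPP; intro Hn.
    destruct (exchange_in X P S) as (p & Hp & Hnp & Hi); auto.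
    - apply maxindep_intro; auto; [now intros z Hz; left|].
      intros r [Hr | Hr] Hnr; auto.
    - apply HS.
    - destruct (classic (R p)) as [HR | HR].
      + apply (maxindep_dep _ _ p HJ'); auto.
        apply (indep_sub _ (add S p)); auto.
        intros w [Hw | Hw]; [left | right]; auto.
      + apply (maxindep_dep _ _ p HS); auto. left; auto. }
  apply (indep_sub _ S); [apply HS|].
  intros p [[Hp HRp] | Hp]; auto.
  apply NNPP; intro HSp.
  destruct (exchange_in X S (fun z => P z /\ z <> p)) as (s & Hs & Hns & Hi);
    auto.
  - apply (indep_sub _ P); auto. now intros z [Hz _].
  - intros z [Hz _]; now left.
  - intro Hmax. apply (maxindep_dep _ _ p Hmax); [now left | tauto |].
    apply (indep_sub _ P); auto. intros z [[Hz _] | ->]; auto.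
  - assert (Hsp : s <> p) by congruence.
    assert (HnP : ~ P s) by tauto.
    assert (HRs : R s) by (destruct (HSX s Hs); tauto).
    apply (maxindep_dep _ _ s HPR); auto; [tauto|].
    apply (indep_sub _ (add (fun z => P z /\ z <> p) s)); auto.
    intros w [[Hw HRw] | ->]; [left | now right].
    split; auto. intros ->; auto.
Qed.

End Matroid.

(** * The finitarization is a matroid *)

Lemma finitarization_indep_incl {T} (M : setsys T) I : is_matroid M ->
  indep M I -> indep (finitarization M) I.
Proof.
  intros HM HI; split; [now apply (indep_ground HM)|].
  intros F _ HF; now apply (indep_sub HM F I).
Qed.

Lemma finitarization_sub {T} (M : setsys T) A B :
  indep (finitarization M) B -> tsubset A B -> indep (finitarization M) A.
Proof.
  intros [HBE HB] HAB; split; [intros x Hx; auto|].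
  intros F HF HFA; apply HB; auto. intros x Hx; auto.
Qed.

Lemma tfinite_sub {T} (A B : tset T) : tfinite B -> tsubset A B -> tfinite A.
Proof. intros [l Hl] H; exists l; intros x Hx; auto. Qed.

(** [tfinite] only provides a list containing the set; deciding membership classically turns it into
    an exact listing without repetitions. *)
Lemma tfinite_enum {T} (A : tset T) : tfinite A ->
  exists l, NoDup l /\ forall x, In x l <-> A x.
Proof.
  intros [l Hl]; revert A Hl; induction l as [|a l IH]; intros A Hl.
  { exists nil; split; [constructor|]. intros z; split; [intros [] | apply Hl]. }
  destruct (IH (fun z => A z /\ z <> a)) as (l' & Hnd & Hl').
  { intros z [Hz Hza]. destruct (Hl z Hz); [congruence | auto]. }
  destruct (classic (A a)) as [Ha | Ha].
  - exists (a :: l'); split.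
    + constructor; auto. rewrite Hl'; tauto.
    + intros z; simpl; rewrite Hl'; split.
      * intros [-> | [Hz _]]; auto.
      * intros Hz. destruct (classic (z = a)); [now left | right; auto].
  - exists l'; split; auto. intros z; rewrite Hl'; split; [tauto|].
    intro Hz; split; auto. now intros ->.
Qed.

Lemma finitarization_dep_add {T} (M : setsys T) A x : is_matroid M ->
  indep (finitarization M) A -> ground M x ->
  ~ indep (finitarization M) (add A x) ->
  exists F, tfinite F /\ tsubset F A /\ ~ indep M (add F x).
Proof.
  intros HM [HAE HA] Hx Hd; apply NNPP; intro Hn; apply Hd; split.
  - intros z [Hz | ->]; auto.
  - intros F HF HFA; apply NNPP; intro HFd; apply Hn.
    exists (fun z => F z /\ z <> x); split; [|split].
    + apply (tfinite_sub _ F); auto. now intros z [Hz _].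
    + intros z [Hz Hzx]. destruct (HFA z Hz); tauto.
    + intro Hi; apply HFd, (indep_sub HM _ _ Hi).
      intros z Hz. destruct (classic (z = x)); [now right | left; auto].
Qed.

(** Replaces [A] by one finite subset that already blocks every element of [l], so that exchange can
    be carried out in [M] itself. *)
Lemma finitely_many_witnesses {T} (M : setsys T) A (l : list T) :
  is_matroid M -> indep (finitarization M) A -> tsubset (fun b => In b l) (ground M) ->
  (forall b, In b l -> ~ A b -> ~ indep (finitarization M) (add A b)) ->
  exists F, tfinite F /\ tsubset F A /\ (forall b, In b l -> A b -> F b) /\
    (forall b, In b l -> ~ A b -> ~ indep M (add F b)).
Proof.
  intros HM HA; induction l as [|b l IH]; intros Hl H.
  { exists tempty; split; [exists nil; intros x []|].
    split; [intros x []|]. split; intros b []. }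
  destruct IH as (F & [m Hm] & HFA & HF1 & HF2).
  { intros c Hc; apply Hl; now right. }
  { intros c Hc; apply H; now right. }
  destruct (classic (A b)) as [HAb | HAb].
  - exists (add F b); split; [|split; [|split]].
    + exists (b :: m). intros z [Hz | ->]; [right; auto | now left].
    + intros z [Hz | ->]; auto.
    + intros c [-> | Hc] HAc; [now right | left; auto].
    + intros c [-> | Hc] HAc; [tauto|]. intro Hi; apply (HF2 c Hc HAc).
      apply (indep_sub HM _ _ Hi). intros z [Hz | Hz]; [left; now left | now right].
  - destruct (finitarization_dep_add M A b) as (G & [m' Hm'] & HGA & HG); auto.
    { apply Hl; now left. }
    { apply H; auto. now left. }
    exists (fun z => F z \/ G z); split; [|split; [|split]].
    + exists (m ++ m'). intros z [Hz | Hz]; apply in_or_app; auto.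
    + intros z [Hz | Hz]; auto.
    + intros c [-> | Hc] HAc; [tauto | left; auto].
    + intros c [<- | Hc] HAc Hi; [apply HG | apply (HF2 c Hc HAc)];
        apply (indep_sub HM _ _ Hi); intros z [Hz | Hz];
        (now right) || (left; auto).
Qed.

Lemma finitarization_exchange {T} (M : setsys T) A B : is_matroid M ->
  base (finitarization M) B -> indep (finitarization M) A ->
  ~ base (finitarization M) A ->
  exists b, B b /\ ~ A b /\ indep (finitarization M) (add A b).
Proof.
  intros HM [HB HBmax] HA HnA.
  assert (Hx : exists x, ~ A x /\ indep (finitarization M) (add A x)).
  { apply NNPP; intro Hn; apply HnA; split; auto.
    intros A' HA' HAA' x Hx; apply NNPP; intro Hnx; apply Hn; exists x.
    split; auto. apply (finitarization_sub M _ A'); auto.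
    intros z [Hz | ->]; auto. }
  destruct Hx as (x & HAx & HAxi).
  assert (HxE : ground M x) by (apply (proj1 HAxi); now right).
  destruct (classic (B x)) as [HBx | HBx]; [now exists x|].
  destruct (finitarization_dep_add M B x) as (F & [l Hl] & HFB & HF); auto.
  { intro Hi; apply HBx. apply (HBmax (add B x)); auto.
    - intros z Hz; now left.
    - now right. }
  apply NNPP; intro Hn.
  destruct (tfinite_enum F) as (l' & _ & Hl'); [now exists l|].
  destruct (finitely_many_witnesses M A l') as (A0 & HA0f & HA0A & H1 & H2); auto.
  { intros b Hb; apply (proj1 HB), HFB, Hl', Hb. }
  { intros b Hb HAb Hi; apply Hn; exists b; split; auto. apply HFB, Hl', Hb. }
  (* In this finite set, [S] contains [F] and so omits [x], while [A0] can be enlarged by [x].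
     Exchange therefore adds to [A0] an element of [F], but all of these lie in [A0] or are blocked
     by it. *)
  set (X := fun z => A0 z \/ F z \/ z = x).
  assert (HXE : tsubset X (ground M)).
  { intros z [Hz | [Hz | ->]]; auto.
    - apply (proj1 HA); auto.
    - apply (proj1 HB); auto. }
  destruct (maxindep_extend HM F X) as (S & HS & HFS); auto.
  { apply (proj2 HB); auto. exists l; auto. }
  { intros z Hz; right; now left. }
  assert (HSx : ~ S x).
  { intro Hx; apply HF, (indep_sub HM _ S); [apply HS|].
    intros z [Hz | ->]; auto. }
  assert (HA0x : indep M (add A0 x)).
  { apply (proj2 HAxi).
    - destruct HA0f as [m Hm]; exists (x :: m).
      intros z [Hz | ->]; [right; auto | now left].
    - intros z [Hz | ->]; [left; auto | now right]. }
  destruct (exchange_in HM X S A0) as (s & Hs & Hns & Hi); auto.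
  - apply (proj2 HA); auto.
  - intros z Hz; now left.
  - intro Hmax. apply (maxindep_dep X A0 x Hmax); auto.
    right; now right.
  - destruct (proj1 (proj2 HS) s Hs) as [Hs' | [Hs' | ->]]; auto.
    apply Hl' in Hs'. destruct (classic (A s)) as [HAs | HAs].
    + apply Hns; auto.
    + apply (H2 s); auto.
Qed.

(** Finitely many members of a chain have a largest one. The first alternative keeps the statement
    true for the empty chain. *)
Lemma finite_in_chain_union {T} (F : tset (tset T)) (A : tset T) (l : list T) :
  classical_sets.total_on F tsubset ->
  (forall x, In x l -> A x \/ exists2 Y, F Y & Y x) ->
  (forall x, In x l -> A x) \/
  exists2 Y, F Y & forall x, In x l -> A x \/ Y x.
Proof.
  intros HF; induction l as [|a l IH]; intros H.
  { left; intros x []. }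
  destruct IH as [IH | [Y HY IH]].
  - intros x Hx; apply H; now right.
  - destruct (H a) as [Ha | [Y HY Ha]]; [now left | left | right].
    + intros x [<- | Hx]; auto.
    + exists Y; auto. intros x [<- | Hx]; auto.
  - right. destruct (H a) as [Ha | [Z HZ Ha]]; [now left | |].
    + exists Y; auto. intros x [<- | Hx]; auto.
    + destruct (HF Y Z HY HZ) as [HYZ | HZY].
      * exists Z; auto. intros x [<- | Hx]; auto.
        destruct (IH x Hx); auto.
      * exists Y; auto. intros x [<- | Hx]; auto.
Qed.

Lemma finitarization_extend {T} (M : setsys T) A X : is_matroid M ->
  indep (finitarization M) A -> tsubset A X -> tsubset X (ground M) ->
  exists S, maxindep_in (finitarization M) X S /\ tsubset A S.
Proof.
  intros HM HA HAX HXE.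
  (* Zorn ranges over the sets [Y] to be joined to [A] rather than over supersets of [A], because
     the union of the empty chain must qualify too. *)
  destruct (@classical_sets.Zorn_bigcup T (fun Y => tsubset Y X /\
    indep (finitarization M) (fun z => A z \/ Y z))) as (Y & [HYX HY] & Hmax).
  { intros F HFP HFt; split.
    { intros z [Y HY Hz]. now apply (proj1 (HFP Y HY)). }
    split.
    { intros z [Hz | [Y HY Hz]]; [auto | now apply HXE, (HFP Y HY)]. }
    intros G [l Hl] HG.
    destruct (tfinite_enum G) as (l' & _ & Hl'); [now exists l|].
    destruct (finite_in_chain_union F A l') as [H | [Y HY H]]; auto.
    - intros x Hx. apply HG, Hl', Hx.
    - apply (proj2 HA); [now exists l|]. intros z Hz; apply H, Hl', Hz.
    - apply (proj2 (proj2 (HFP Y HY))); [now exists l|].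
      intros z Hz; apply H, Hl', Hz. }
  exists (fun z => A z \/ Y z); split; [split; [|split]|]; auto.
  - intros z [Hz | Hz]; auto.
  - intros S' HS' HS HS'X z Hz; apply NNPP; intro Hn.
    apply (Hmax S').
    + split; [intros w Hw; apply HS; now right|].
      intro H; apply Hn; right; now apply H.
    + split; auto. apply (finitarization_sub M _ S'); auto.
      intros w [Hw | Hw]; auto.
  - intros z Hz; now left.
Qed.

Lemma finitarization_matroid {T} (M : setsys T) :
  is_matroid M -> is_matroid (finitarization M).
Proof.
  intro HM; split; [|split; [|split; [|split]]].
  - now intros I [HI _].
  - apply finitarization_indep_incl; auto. apply HM.
  - intros A B; apply finitarization_sub.
  - intros A B HB HA HnA; now apply finitarization_exchange.
  - intros A X HA HAX HXE; exact (finitarization_extend M A X HM HA HAX HXE).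
Qed.

(** * The dual is a matroid *)

Lemma dual_matroid {T} (M : setsys T) : is_matroid M -> is_matroid (dual M).
Proof.
  intro HM; split; [|split; [|split; [|split]]].
  - now intros I [HI _].
  - destruct (base_extend HM tempty) as (B & HB & _); [apply HM|].
    split; [intros x [] | exists B; split; auto].
  - intros A B [HBE (B0 & HB0 & Hdis)] HAB; split; [intros x Hx; auto|].
    exists B0; split; auto.
  - intros A Bs [[HBsE (B2 & HB2 & Hdis)] HBsmax] [HAE (B1 & HB1 & HA1)] HnA.
    apply NNPP; intro Hn.
    assert (Hcov : forall z, ground M z -> ~ B2 z -> Bs z).
    { intros z Hz Hnz. apply (HBsmax (add Bs z)).
      - split; [intros w [Hw | ->]; auto|].
        exists B2; split; auto. intros w [Hw | ->]; auto.
      - intros w Hw; now left.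
      - now right. }
    set (Y := fun z => ground M z /\ ~ A z).
    destruct (maxindep_extend HM (fun z => B2 z /\ ~ A z) Y) as (I & HI & HBI).
    { apply (indep_sub HM _ B2); [apply HB2|]. now intros z [Hz _]. }
    { intros z [Hz HAz]; split; auto. now apply (indep_ground HM B2); [apply HB2|]. }
    { now intros z [Hz _]. }
    assert (HIb : base M I).
    { apply (maxindep_base HM Y B1); auto.
      intros z Hz; split; [now apply (indep_ground HM B1); [apply HB1|]|].
      intro HAz; now apply (HA1 z). }
    (* An element [e] outside [A] and the base [I] is outside [B2], hence in [Bs], and could be
       added to [A]. So [A] is the complement of the base [I], making it a base of the dual. *)
    assert (HIY : forall e, ground M e -> ~ A e -> I e).
    { intros e He HAe; apply NNPP; intro HIe.
      destruct (classic (B2 e)) as [H2 | H2]; [apply HIe, HBI; auto|].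
      apply Hn; exists e; split; [|split]; auto.
      split; [intros w [Hw | ->]; auto|].
      exists I; split; auto. intros w [Hw | ->]; auto.
      intro HIw. now apply (proj1 (proj2 HI) w). }
    apply HnA; split; [split; auto; exists B1; auto|].
    intros A' [HA'E (B3 & HB3 & HA3)] HAA' x Hx; apply NNPP; intro HAx.
    apply (HA3 x Hx). apply (proj2 HB3 I (proj1 HI)); auto.
    intros z Hz. apply HIY; [now apply (indep_ground HM B3); [apply HB3|]|].
    intro HAz; apply (HA3 z); auto.
  - intros A X [HAE (B1 & HB1 & HA1)] HAX HXE.
    change (tsubset X (ground M)) in HXE.
    set (Y := fun z => ground M z /\ ~ X z).
    set (Z := fun z => ground M z /\ ~ A z).
    destruct (maxindep_extend HM tempty Y) as (I & HI & _).
    { apply HM. } { intros x []. } { now intros z [Hz _]. }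
    destruct (maxindep_extend HM I Z) as (I2 & HI2 & HII2).
    { apply HI. }
    { intros z Hz. destruct (proj1 (proj2 HI) z Hz); split; auto. }
    { now intros z [Hz _]. }
    assert (HI2b : base M I2).
    { apply (maxindep_base HM Z B1); auto.
      intros z Hz; split; [now apply (indep_ground HM B1); [apply HB1|]|].
      intro HAz; now apply (HA1 z). }
    (* The base [I2] avoids [A] and meets the complement of [X] in as much as possible. If a larger
       dual-independent set contained some [y] of [I2], exchanging [y] for an element of [B3] would
       enlarge [I] outside [X]. *)
    exists (fun z => X z /\ ~ I2 z); split; [split; [|split]|].
    + split; [intros z [Hz _]; auto|]. exists I2; split; auto. tauto.
    + now intros z [Hz _].
    + intros S' [HS'E (B3 & HB3 & HS3)] HSS' HS'X y Hy; split; auto; intro HyI.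
      destruct (base_exchange HM (fun z => I2 z /\ z <> y) B3)
        as (b & Hb & Hnb & Hi); auto.
      * apply (indep_sub HM _ I2); [apply HI2|]. now intros z [Hz _].
      * intros [_ Hm]. destruct (Hm I2 (proj1 HI2)) with y; auto.
        now intros z [Hz _].
      * assert (Hby : b <> y) by (intros ->; now apply (HS3 y)).
        destruct (classic (X b)) as [HXb | HXb].
        -- apply (HS3 b); auto. apply HSS'; split; auto.
        -- apply (maxindep_dep Y I b HI); auto.
           ++ split; auto. now apply (indep_ground HM B3); [apply HB3|].
           ++ apply (indep_sub HM _ _ Hi).
              intros w [Hw | ->]; [left | now right]. split; auto.
              intros ->. now apply (proj1 (proj2 HI) y) in Hw as [_ Hw]; auto.
    + intros z Hz; split; auto. intro HIz.
      now apply (proj1 (proj2 HI2) z) in HIz as [_ HIz].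
Qed.

(** * Covers by two independent sets and chains of single exchanges *)

Definition cover {T} (A B : setsys T) (D : tset T) : Prop :=
  exists P C, indep A P /\ indep B C /\
    forall z, ground A z -> P z \/ C z \/ D z.

Lemma cover_mono {T} (A B : setsys T) D D' : cover A B D ->
  (forall z, ground A z -> D z -> D' z) -> cover A B D'.
Proof.
  intros (P & C & HP & HC & H) HD; exists P, C; split; [|split]; auto.
  intros z Hz; destruct (H z Hz) as [? | [? | ?]]; auto.
Qed.

(* [reach P C x]: single exchanges, starting with [P0], [C0] and the uncovered
   element [d], lead to [P], [C] and the uncovered element [x]. *)
Inductive reach {T} (A B : setsys T) (P0 C0 : tset T) (d : T) :
  tset T -> tset T -> T -> Prop :=
| reach_start : reach A B P0 C0 d P0 C0 d
| reach_left P C x y : reach A B P0 C0 d P C x -> P y ->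
    indep A (swap P y x) -> reach A B P0 C0 d (swap P y x) C y
| reach_right P C x y : reach A B P0 C0 d P C x -> C y ->
    indep B (swap C y x) -> reach A B P0 C0 d P (swap C y x) y.

Definition reachable {T} (A B : setsys T) P0 C0 d (x : T) : Prop :=
  exists P C, reach A B P0 C0 d P C x.

Lemma reach_sym {T} (A B : setsys T) P0 C0 d P C x :
  reach A B P0 C0 d P C x -> reach B A C0 P0 d C P x.
Proof. induction 1; econstructor; eauto. Qed.

(** Transfers results about the [A] side to the [B] side; an equality of sets allows rewriting. *)
Lemma reachable_sym {T} (A B : setsys T) P0 C0 d :
  reachable A B P0 C0 d = reachable B A C0 P0 d.
Proof.
  apply tset_ext; intro x; split; intros (P & C & H); exists C, P;
    now apply reach_sym.
Qed.

Lemma cover_sym {T} (A B : setsys T) D : ground A = ground B ->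
  cover A B D -> cover B A D.
Proof.
  intros HE (P & C & HP & HC & H); exists C, P; rewrite <- HE.
  split; [|split]; auto. intros z Hz; specialize (H z Hz); tauto.
Qed.

Section Exchange.
Context {T : Type} {A B : setsys T}.
Context (HA : is_matroid A) (HB : is_matroid B) (HE : ground A = ground B).
Context (W P0 C0 : tset T) (d : T).
Context (HP0 : indep A P0) (HC0 : indep B C0) (Hd : ground A d).
Context (Hcov : forall z, ground A z -> P0 z \/ C0 z \/ add W d z).
Context (HW : ~ cover A B W).

(** An exchange brings [x] in and takes [y] out, so at most [y] becomes newly uncovered. *)
Lemma reach_inv P C x : reach A B P0 C0 d P C x ->
  indep A P /\ indep B C /\ ground A x /\
  forall z, ground A z -> P z \/ C z \/ add W x z.
Proof.
  induction 1 as [| P C x y _ (HP & HC & Hx & H) HPy HS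
                  | P C x y _ (HP & HC & Hx & H) HCy HS].
  - auto.
  - split; [|split; [|split]]; auto; [now apply (indep_ground HA P)|].
    intros z Hz. unfold swap, add in *.
    destruct (classic (z = y)), (classic (z = x)); auto.
    destruct (H z Hz) as [? | [? | [? | ?]]]; auto.
  - split; [|split; [|split]]; auto.
    { rewrite HE; now apply (indep_ground HB C). }
    intros z Hz. unfold swap, add in *.
    destruct (classic (z = y)), (classic (z = x)); auto.
    destruct (H z Hz) as [? | [? | [? | ?]]]; auto.
Qed.

Lemma reach_not_in P C x : reach A B P0 C0 d P C x -> ~ P x.
Proof.
  intros Hr HPx. apply reach_inv in Hr as (HP & HC & Hx & H).
  apply HW; exists P, C; split; [|split]; auto.
  intros z Hz. destruct (H z Hz) as [? | [? | [? | ->]]]; auto.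
Qed.

(** [add P x] is dependent, as otherwise [W] would be a cover. The circuit of [x] in [P] is
    reachable, since each of its elements [y] can be exchanged for [x]. *)
Lemma reach_dep P C x : reach A B P0 C0 d P C x ->
  ~ indep A (add (fun z => P z /\ reachable A B P0 C0 d z) x).
Proof.
  intros Hr. destruct (reach_inv P C x Hr) as (HP & HC & Hx & H).
  apply (fundamental_circuit HA P); auto.
  - intro Hi. apply HW; exists (add P x), C; split; [|split]; auto.
    intros z Hz. unfold add in *.
    destruct (H z Hz) as [? | [? | [? | ->]]]; auto.
  - now intros z [Hz _].
  - intros y Hy Hi; split; auto.
    exists (swap P y x), C. now apply reach_left.
Qed.

(** Walks back along the chain: a left exchange preserves the bound on the span by [reach_dep] and
    [spans_swap], and a right exchange leaves [P] alone. *)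
Lemma reach_spans P C x : reach A B P0 C0 d P C x ->
  forall z, ground A z ->
  spans (M := A) (fun w => P w /\ reachable A B P0 C0 d w) z ->
  spans (M := A) (fun w => P0 w /\ reachable A B P0 C0 d w) z.
Proof.
  set (R := reachable A B P0 C0 d).
  induction 1 as [| P C x y Hr IH HPy HS | P C x y Hr IH HCy HS]; auto.
  intros z Hz Hsp; apply IH; auto.
  assert (HRx : R x) by now exists P, C.
  assert (HRy : R y) by (exists (swap P y x), C; now apply reach_left).
  assert (Hnx := reach_not_in P C x Hr).
  assert (Heq : (fun w => swap P y x w /\ R w) =
                swap (fun w => P w /\ R w) y x).
  { apply tset_ext; intro w; unfold swap; split; [tauto|].
    intros [? | ->]; tauto. }
  rewrite Heq in Hsp.
  apply (spans_swap HA _ x y); auto.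
  - rewrite <- Heq. apply (indep_sub HA _ (swap P y x)); auto.
    now intros w [Hw _].
  - apply (indep_sub HA _ P); [now apply (reach_inv P C x)|].
    now intros w [Hw _].
  - tauto.
  - now apply (reach_dep P C x).
Qed.

Lemma reachable_ground x : reachable A B P0 C0 d x -> ground A x.
Proof. intros (P & C & Hr); now apply (reach_inv P C). Qed.

(** A reachable [x] is spanned by the reachable part of its own [P], hence by that of [P0]. *)
Lemma reachable_maxindep : maxindep_in A (reachable A B P0 C0 d)
  (fun z => P0 z /\ reachable A B P0 C0 d z).
Proof.
  apply (maxindep_intro HA).
  - apply (indep_sub HA _ P0); auto. now intros z [Hz _].
  - now intros z [_ Hz].
  - intros x Hx Hnx. destruct Hx as (P & C & Hr).
    destruct (reach_spans P C x Hr x) as [H | H]; auto.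
    + now apply (reach_inv P C).
    + right; now apply (reach_dep P C).
Qed.

End Exchange.

(* If every reachable element is covered by [J1] and [J2], then exchanging the
   reachable parts of [P0] and [C0] for those of [J1] and [J2] also covers [d]. *)
Lemma cover_exchange {T} (A B : setsys T) W d D :
  is_matroid A -> is_matroid B -> ground A = ground B -> ground A d ->
  cover A B (add W d) -> ~ cover A B W -> cover A B D ->
  exists z, D z /\ cover A B (add W z).
Proof.
  intros HA HB HE Hd (P0 & C0 & HP0 & HC0 & Hcov) HW (J1 & J2 & HJ1 & HJ2 & HJ).
  apply NNPP; intro Hn.
  assert (HW' : ~ cover B A W).
  { intro H; apply HW; now apply cover_sym. }
  assert (Hcov' : forall z, ground B z -> C0 z \/ P0 z \/ add W d z).
  { rewrite <- HE; intros z Hz; specialize (Hcov z Hz); tauto. }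
  set (R := reachable A B P0 C0 d).
  assert (HRE : tsubset R (ground A)).
  { intros x; now apply (reachable_ground HA HB HE W). }
  assert (HRA : maxindep_in A R (fun z => P0 z /\ R z)).
  { now apply (reachable_maxindep HA HB HE W). }
  assert (HRB : maxindep_in B R (fun z => C0 z /\ R z)).
  { unfold R; rewrite reachable_sym.
    apply (reachable_maxindep HB HA (eq_sym HE) W); auto. now rewrite <- HE. }
  (* A reachable [z] in [D] would be the required element, because its pair [P], [C] leaves only [W]
     and [z] uncovered. *)
  assert (HRJ : forall z, R z -> J1 z \/ J2 z).
  { intros z Hz. destruct (HJ z (HRE z Hz)) as [? | [? | HDz]]; auto.
    exfalso; apply Hn; exists z; split; auto.
    destruct Hz as (P & C & Hr).
    destruct (reach_inv HA HB HE W P0 C0 d HP0 HC0 Hd Hcov P C z Hr)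
      as (HP & HC & _ & H).
    exists P, C; auto. }
  apply HW.
  exists (fun z => (P0 z /\ ~ R z) \/ (J1 z /\ R z)),
         (fun z => (C0 z /\ ~ R z) \/ (J2 z /\ R z)).
  split; [|split].
  - apply (indep_replace HA R P0 (fun z => J1 z /\ R z)); auto.
    + apply (indep_sub HA _ J1); auto. now intros z [Hz _].
    + now intros z [_ Hz].
  - apply (indep_replace HB R C0 (fun z => J2 z /\ R z)); auto.
    + now rewrite <- HE.
    + apply (indep_sub HB _ J2); auto. now intros z [Hz _].
    + now intros z [_ Hz].
  - intros z Hz. destruct (classic (R z)) as [HRz | HRz].
    + destruct (HRJ z HRz); tauto.
    + destruct (Hcov z Hz) as [? | [? | [? | ->]]]; try tauto.
      exfalso; apply HRz. exists P0, C0; constructor.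
Qed.

(** * Finite covers of least size *)

(** Lists make size a length; minimality itself rules out repetitions. *)
Definition min_cover {T} (A B : setsys T) (l : list T) : Prop :=
  cover A B (fun x => In x l) /\
  forall l', cover A B (fun x => In x l') -> length l <= length l'.

Lemma min_cover_exists {T} (A B : setsys T) l : cover A B (fun x => In x l) ->
  exists l', min_cover A B l'.
Proof.
  remember (length l) as n eqn:Hn. revert l Hn.
  induction n as [n IH] using (well_founded_induction Wf_nat.lt_wf).
  intros l -> Hl. apply NNPP; intro H.
  apply H; exists l; split; auto. intros l' Hl'.
  destruct (Compare_dec.le_gt_dec (length l) (length l')) as [|Hlt]; auto.
  exfalso; apply H, (IH (length l') Hlt l'); auto.
Qed.

Lemma min_cover_drop {T} (A B : setsys T) l1 d l2 :
  min_cover A B (l1 ++ d :: l2) -> ~ cover A B (fun x => In x (l1 ++ l2)).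
Proof.
  intros [_ H] Hc; apply H in Hc. rewrite !length_app in Hc; simpl in Hc; lia.
Qed.

Lemma min_cover_ground {T} (A B : setsys T) l x :
  min_cover A B l -> In x l -> ground A x.
Proof.
  intros Hl Hx; apply NNPP; intro Hn.
  destruct (in_split x l Hx) as (l1 & l2 & ->).
  apply (min_cover_drop A B l1 x l2 Hl), (cover_mono _ _ _ _ (proj1 Hl)).
  intros z Hz; rewrite !in_app_iff; simpl. intros [? | [-> | ?]]; tauto.
Qed.

Lemma min_cover_NoDup {T} (A B : setsys T) l : min_cover A B l -> NoDup l.
Proof.
  intros Hl; apply NNPP; intro Hn.
  destruct (tfinite_enum (fun x => In x l)) as (l' & Hnd & Hl'); [now exists l|].
  assert (Hle : length l <= length l').
  { apply (proj2 Hl), (cover_mono _ _ _ _ (proj1 Hl)). intros z _; apply Hl'. }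
  apply Hn, (NoDup_incl_NoDup Hnd); auto. intros z; apply Hl'.
Qed.

Lemma min_cover_of_le {T} (A B : setsys T) l l' : min_cover A B l ->
  cover A B (fun x => In x l') -> length l' <= length l -> min_cover A B l'.
Proof.
  intros [_ H] Hl' Hle; split; auto.
  intros m Hm; specialize (H m Hm); lia.
Qed.

(** By minimality the list without [d] is not a cover, so [cover_exchange] applies with it as [W];
    the new list has the old length. *)
Lemma min_cover_swap {T} (A B : setsys T) l1 d l2 D :
  is_matroid A -> is_matroid B -> ground A = ground B ->
  min_cover A B (l1 ++ d :: l2) -> cover A B D ->
  exists z, D z /\ min_cover A B (z :: l1 ++ l2).
Proof.
  intros HA HB HE Hl HD.
  destruct (cover_exchange A B (fun x => In x (l1 ++ l2)) d D)
    as (z & HDz & Hz); auto.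
  - apply (min_cover_ground A B _ d Hl), in_elt.
  - apply (cover_mono _ _ _ _ (proj1 Hl)). intros z _; unfold add.
    rewrite !in_app_iff; simpl. intros [? | [-> | ?]]; tauto.
  - now apply min_cover_drop with d.
  - exists z; split; auto. apply (min_cover_of_le _ _ _ _ Hl).
    + apply (cover_mono _ _ _ _ Hz). intros w _ [Hw | ->]; simpl; auto.
    + simpl; rewrite !length_app; simpl; lia.
Qed.

Lemma min_cover_within {T} (A B : setsys T) l D :
  is_matroid A -> is_matroid B -> ground A = ground B ->
  min_cover A B l -> cover A B D ->
  exists l', min_cover A B l' /\ forall x, In x l' -> D x.
Proof.
  intros HA HB HE Hl HD.
  (* The elements are exchanged one at a time: [a] is already inside [D], and [r] is still to be
     treated. *)
  enough (H : forall r a, min_cover A B (a ++ r) -> (forall x, In x a -> D x) ->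
    exists l', min_cover A B l' /\ forall x, In x l' -> D x).
  { apply (H l nil); auto. intros x []. }
  induction r as [|d r IH]; intros a Har Ha.
  - exists a; rewrite app_nil_r in Har; auto.
  - destruct (min_cover_swap A B a d r D) as (z & HDz & Hz); auto.
    apply (IH (z :: a)); auto. intros x [<- | Hx]; auto.
Qed.

(** * The dual of the union as the system of subsets of least covers *)

Lemma dual_munion_indep {T} (A B : setsys T) l0 I :
  is_matroid A -> is_matroid B -> ground A = ground B -> min_cover A B l0 ->
  indep (dual (munion A B)) I <->
  exists l, min_cover A B l /\ forall x, I x -> In x l.
Proof.
  intros HA HB HE Hl0; split.
  - intros [HIE (U & [(S & V & HS & HV & HU) Hmax] & HIU)]; simpl in *.
    destruct (min_cover_within A B l0 (fun z => ~ U z)) as (l & Hl & HlU); auto.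
    { exists S, V; split; [|split]; auto. intros z _; rewrite HU; tauto. }
    exists l; split; auto.
    destruct (proj1 Hl) as (P & C & HP & HC & Hcov).
    intros x Hx.
    assert (HxE : ground A x) by (destruct (HIE x Hx); congruence).
    (* [U] avoids [l], so it lies in the union of [P] and [C]; being a base, it equals that union,
       and its complement lies in [l]. *)
    assert (HPC : tsubset (fun z => P z \/ C z) U).
    { apply Hmax; [exists P, C; split; [|split]; auto; tauto|].
      intros z Hz. assert (HzE : ground A z).
      { apply HU in Hz as [Hz | Hz]; [now apply (indep_ground HA S)|].
        rewrite HE; now apply (indep_ground HB V). }
      destruct (Hcov z HzE) as [? | [? | Hzl]]; auto.
      now apply HlU in Hzl. }
    destruct (Hcov x HxE) as [? | [? | Hxl]]; auto;
      exfalso; apply (HIU x Hx), HPC; auto.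
  - intros (l & Hl & HIl).
    (* A pair covering everything outside [l] cannot contain an element of [l], since dropping it
       would give a shorter cover. This yields both that [P] and [C] form a base and that [I] avoids
       it. *)
    assert (Hdrop : forall S V x, indep A S -> indep B V -> In x l ->
      (forall z, ground A z -> S z \/ V z \/ In z l) -> S x \/ V x -> False).
    { intros S V x HS HV Hx Hcov HSV.
      destruct (in_split x l Hx) as (l1 & l2 & ->).
      apply (min_cover_drop A B l1 x l2 Hl). exists S, V; split; [|split]; auto.
      intros z Hz; destruct (Hcov z Hz) as [? | [? | Hzl]]; auto.
      rewrite !in_app_iff in *; simpl in Hzl.
      destruct Hzl as [? | [<- | ?]]; tauto. }
    split; [intros x Hx; left; now apply (min_cover_ground A B l); auto|].
    destruct (proj1 Hl) as (P & C & HP & HC & Hcov).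
    exists (fun z => P z \/ C z); split; [split|].
    + exists P, C; split; [|split]; auto; tauto.
    + intros B' (S & V & HS & HV & HB') HPC x Hx; apply NNPP; intro Hn.
      assert (HxE : ground A x).
      { apply HB' in Hx as [Hx | Hx]; [now apply (indep_ground HA S)|].
        rewrite HE; now apply (indep_ground HB V). }
      apply (Hdrop S V x); auto.
      * destruct (Hcov x HxE) as [? | [? | ?]]; tauto.
      * intros z Hz. destruct (Hcov z Hz) as [? | [? | ?]]; auto;
          rewrite <- or_assoc, <- HB'; auto.
      * now apply HB'.
    + intros x Hx HPC. apply (Hdrop P C x); auto.
Qed.

Lemma dual_munion_matroid {T} (A B : setsys T) l0 :
  is_matroid A -> is_matroid B -> ground A = ground B ->
  cover A B (fun x => In x l0) -> is_matroid (dual (munion A B)).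
Proof.
  intros HA HB HE Hl0. apply min_cover_exists in Hl0 as [l Hl]. clear l0.
  assert (HL := fun I => dual_munion_indep A B l I HA HB HE Hl).
  split; [|split; [|split; [|split]]].
  - now intros I [HI _].
  - apply HL; exists l; split; auto. intros x [].
  - intros I J HJ HIJ; apply HL; apply HL in HJ as (m & Hm & HJm).
    exists m; split; auto.
  - intros I S [HS HSmax] HI HnI.
    apply HL in HS as (lS & HlS & HSl). apply HL in HI as (lI & HlI & HIl).
    assert (HlSS : forall x, In x lS -> S x).
    { apply HSmax; auto. apply HL; now exists lS. }
    (* If [I] contained all of [lI], it would be a base, since all least covers have the same number
       of elements. *)
    assert (Hd : exists d, In d lI /\ ~ I d).
    { apply NNPP; intro Hn; apply HnI; split; [apply HL; now exists lI|].
      intros J HJ HIJ x Hx. apply HL in HJ as (lJ & HlJ & HJl).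
      assert (HlII : forall y, In y lI -> I y).
      { intros y Hy; apply NNPP; intro; apply Hn; eauto. }
      apply HlII.
      apply (NoDup_length_incl (l := lI) (l' := lJ)); auto.
      - apply (min_cover_NoDup A B lI HlI).
      - apply (proj2 HlJ), HlI.
      - intros y Hy; auto. }
    destruct Hd as (d & HdI & Hd).
    destruct (classic (S d)) as [HSd | HSd].
    { exists d; split; [|split]; auto. apply HL; exists lI; split; auto.
      intros x [Hx | ->]; auto. }
    destruct (in_split d lI HdI) as (l1 & l2 & ->).
    (* [S] contains [lS], so it is a cover and can supply a replacement for [d]. The new list has no
       repetitions, so [z] is outside [I]. *)
    destruct (min_cover_swap A B l1 d l2 S) as (z & HSz & Hz); auto.
    { apply (cover_mono _ _ _ _ (proj1 HlS)). auto. }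
    assert (Hsub : forall x, I x -> In x (l1 ++ l2)).
    { intros x Hx. specialize (HIl x Hx). rewrite in_app_iff in *.
      destruct HIl as [? | [<- | ?]]; tauto. }
    exists z; split; [|split]; auto.
    + intro HIz. apply min_cover_NoDup in Hz. inversion Hz; auto.
    + apply HL; exists (z :: l1 ++ l2); split; auto.
      intros x [Hx | ->]; [right; auto | now left].
  - intros I X HI HIX HXE.
    assert (Hfin : forall J, indep (dual (munion A B)) J ->
      exists m, NoDup m /\ (forall x, In x m <-> J x) /\ length m <= length l).
    { intros J HJ. apply HL in HJ as (lJ & HlJ & HJl).
      destruct (tfinite_enum J) as (m & Hm & HmJ); [now exists lJ|].
      exists m; split; [|split]; auto.
      transitivity (length lJ); [|apply (proj2 HlJ), Hl].
      apply NoDup_incl_length; auto. intros x Hx; apply HJl, HmJ, Hx. }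
    (* Independent sets have at most [length l] elements; [n] bounds how many more [J] can gain. *)
    enough (H : forall n J m, indep (dual (munion A B)) J -> tsubset I J ->
      tsubset J X -> NoDup m -> (forall x, In x m <-> J x) ->
      length l <= length m + n ->
      exists S, maxindep_in (dual (munion A B)) X S /\ tsubset I S).
    { destruct (Hfin I HI) as (m & Hm & HmI & _).
      apply (H (length l) I m); auto; [now intros x | lia]. }
    induction n as [|n IH]; intros J m HJ HIJ HJX Hm HmJ Hle;
      (destruct (classic (maxindep_in (dual (munion A B)) X J)) as [|Hnm];
        [now exists J|]).
    all: assert (Hx : exists J' x, indep (dual (munion A B)) J' /\
           tsubset J J' /\ tsubset J' X /\ J' x /\ ~ J x).
    1, 3: apply NNPP; intro Hn; apply Hnm; split; [|split]; auto;
      intros J' HJ' HJJ' HJ'X x Hx; apply NNPP; intro HJx; apply Hn;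
      exists J', x; auto.
    all: destruct Hx as (J' & x & HJ' & HJJ' & HJ'X & Hx & HJx);
      destruct (Hfin J' HJ') as (m' & Hm' & HmJ' & Hle');
      assert (Hlt : length (x :: m) <= length m').
    1, 3: apply NoDup_incl_length; [constructor; auto; now rewrite HmJ|];
      intros y [<- | Hy]; apply HmJ'; auto; apply HJJ', HmJ, Hy.
    + simpl in Hlt; lia.
    + apply (IH J' m'); auto; [now intros y Hy; auto | simpl in Hlt; lia].
Qed.

(** * A finite cover for a nearly finitary matroid *)

Theorem theorem3p4p3 (T : Type) (M : setsys T) :
  is_matroid M -> nearly_finitary M -> nearly_cofinitary M ->
  is_matroid (dual (munion (dual (finitarization M)) M)).
Proof.
  intros HM Hnf _.
  assert (HN := finitarization_matroid M HM).
  destruct (base_extend HM tempty) as (B & HB & _); [apply HM|].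
  destruct (base_extend HN B) as (F & HF & HBF).
  { apply finitarization_indep_incl; auto. apply HB. }
  destruct (Hnf F B HF HB HBF) as [l Hl].
  apply (dual_munion_matroid _ _ l); auto.
  - now apply dual_matroid.
  (* The complement of [F] is independent in the dual of the finitarization; together with [B] it
     misses only [F] minus [B], listed by [l]. *)
  - exists (fun z => ground M z /\ ~ F z), B; split; [|split].
    + split; [now intros z [Hz _]|]. exists F; split; auto. tauto.
    + apply HB.
    + intros z Hz. destruct (classic (F z)), (classic (B z)); auto.
Qed.
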